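(* Let $k > 2$ be an integer. Then there is no upper limit to $\{S_0\}$ as $S_0$ ranges over the $k$-tuples of nonnegative integers; that is, for every positive integer $N$ there exists a $k$-tuple $S_0$ of nonnegative integers with $\{S_0\} \ge N$.
   Context: A ''set'' of $k$ members here means an ordered $k$-tuple $(a_1,\dots,a_k)$ of nonnegative integers (repetitions allowed), with subscripts reduced modulo $k$, so that $a_{k+1} = a_1$. The differencing operator is $|\Delta| a_i = |a_{i+1} - a_i|$ for $i = 1, \dots, k$; in particular $|\Delta| a_k = |a_1 - a_k|$. Starting from an original set $S_0 = (a_1,\dots,a_k)$, the derived sets are $S_n = (|\Delta|^n a_1, \dots, |\Delta|^n a_k)$, where $|\Delta|^0 a_i = a_i$ and $|\Delta|^n a_i = \bigl|\, |\Delta|^{n-1} a_{i+1} - |\Delta|^{n-1} a_i \,\bigr|$ for $n \ge 1$ (subscripts modulo $k$). Since no entry ever exceeds the largest entry of $S_0$, the sequence $S_0, S_1, S_2, \dots$ takes finitely many values, so some repetition occurs. The number of differencings before a set repeats, denoted $\{S_0\}$, is the largest integer $n \ge 0$ such that $S_0, S_1, \dots, S_n$ are pairwise distinct as ordered $k$-tuples (the game terminates just short of the first repetition). For example, for $k=3$ and $S_0 = (2,5,9)$ one has $\{S_0\} = 7$, since $S_8 = S_5$ is the first repetition. When $k$ is a power of $2$, this is the same as the least integer $n \ge 0$ for which every member of $S_n$ is zero. *)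

(* Defs.v *)
From mathcomp Require Import all_boot ssralg ssrnum ssrint.

Set Implicit Arguments.
Unset Strict Implicit.
Unset Printing Implicit Defensive.

(* [ordS] is the cyclic successor on ['I_k]: subscripts are read modulo k.  In
   [`|a - b|%N] the subtraction takes place in [int]; it is not truncated. *)
Definition absdiff (k : nat) (S : k.-tuple nat) : k.-tuple nat :=
  [tuple `|tnth S (ordS i) - tnth S i|%N | i < k].

Definition derived (k : nat) (S : k.-tuple nat) (n : nat) : k.-tuple nat :=
  iter n (@absdiff k) S.

Definition distinct_upto (k : nat) (S : k.-tuple nat) : pred nat :=
  fun n => uniq (mkseq (derived S) n.+1).

Lemma distinct_upto_ex (k : nat) (S : k.-tuple nat) :
  exists n, distinct_upto S n.
Proof. by exists 0. Qed.

Definition max_entry (k : nat) (S : k.-tuple nat) : nat :=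
  \max_(i < k) tnth S i.

Lemma distn_bound (a b m : nat) : a <= m -> b <= m -> `|a - b|%N <= m.
Proof.
move=> am bm; case: (leqP a b) => ab.
  by rewrite distnEr // (leq_trans (leq_subr _ _)).
by rewrite distnEl ?(ltnW ab) // (leq_trans (leq_subr _ _)).
Qed.

Lemma derived_bound (k : nat) (S : k.-tuple nat) (n : nat) (i : 'I_k) :
  tnth (derived S n) i <= max_entry S.
Proof.
elim: n i => [|n IHn] i; first exact: (leq_bigmax i).
by rewrite /derived iterS tnth_mktuple distn_bound ?IHn.
Qed.

Lemma distinct_upto_bound (k : nat) (S : k.-tuple nat) (n : nat) :
  distinct_upto S n -> n <= (max_entry S).+1 ^ k.
Proof.
move=> Un; set M := max_entry S.
pose f (j : nat) : k.-tuple 'I_M.+1 := [tuple inord (tnth (derived S j) i) | i < k].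
have f_inj i j : f i = f j -> derived S i = derived S j.
  move=> fij; apply: eq_from_tnth => l.
  have /(congr1 val) := congr1 (fun t => tnth t l) fij.
  by rewrite !tnth_mktuple /= !inordK // ltnS derived_bound.
have Uf : uniq (mkseq f n.+1).
  apply/mkseq_uniqP => i j ni nj /f_inj; move/mkseq_uniqP: Un; exact.
apply: ltnW; have := max_card (mem (mkseq f n.+1)).
by rewrite (card_uniqP Uf) size_mkseq card_tuple card_ord.
Qed.

(* The largest n such that S_0, ..., S_n are pairwise distinct; the bound on n
   is only used to show that this maximum exists. *)
Definition game_length (k : nat) (S : k.-tuple nat) : nat :=
  ex_maxn (distinct_upto_ex S) (@distinct_upto_bound k S).

(* Main.v *)
(** A real number [q] in ]1, 2[ with [q ^+ k.-1 - 1 = (q - 1) * q ^+ k.-1] makes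
the tuple [(1, q, ..., q ^+ k.-1)] an eigenvector of the differencing operator,
with eigenvalue [q - 1] in ]0, 1[: over the reals its game never ends.  Scale
this eigenvector by a large [M] and truncate its entries.  A differencing at
most doubles the sup-norm error, so the first [N] derived sets stay within
[2 ^+ N] of [M * (q - 1) ^+ n * q ^+ i], which takes well-separated values for
distinct [n <= N] once [M] is large. *)

Require Import Defs.
From mathcomp Require Import all_boot.
From mathcomp Require Import all_order all_algebra realalg lra.

Set Implicit Arguments.
Unset Strict Implicit.
Unset Printing Implicit Defensive.

Import Order.TTheory GRing.Theory Num.Theory.

Local Open Scope ring_scope.

Lemma leq_game_length (k : nat) (S : k.-tuple nat) (n : nat) :
  distinct_upto S n -> (n <= game_length S)%N.
Proof. by rewrite /game_length; case: ex_maxnP => m _; apply. Qed.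

(* [q] is obtained as a root of X^n - X^(n-1) - ... - X - 1. *)
Lemma exists_multinacci (R : rcfType) (n : nat) : (1 < n)%N ->
  exists2 q : R, 1 < q < 2 & q ^+ n - 1 = (q - 1) * q ^+ n.
Proof.
move=> n_gt1; pose p : {poly R} := 'X^n - \sum_(i < n) 'X^i.
have pE x : p.[x] = x ^+ n - \sum_(i < n) x ^+ i.
  by rewrite !hornerE horner_sum; under eq_bigr do rewrite hornerXn.
have p1 : p.[1] < 0.
  rewrite pE expr1n; under eq_bigr do rewrite expr1n.
  by rewrite sumr_const card_ord subr_lt0 ltr1n.
(* At 2 the geometric sum is [2 ^+ n - 1], so [p] changes sign on [1, 2]. *)
have p2 : p.[2] = 1.
  have := subrX1 (2 : R) n; have -> : (2 : R) - 1 = 1 by lra.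
  by rewrite mul1r pE => <-; lra.
have [||q /andP[q_ge1 q_le2] /eqP pq0] := @poly_ivt R p 1 2.
- by rewrite ler1n.
- by rewrite p2 ler01 ltW.
exists q.
  rewrite !lt_def q_ge1 q_le2 !andbT; apply/andP; split.
    by apply/eqP=> q1; move: p1; rewrite -q1 pq0 ltxx.
  by apply/eqP=> q2; move: p2; rewrite q2 pq0 => /eqP; rewrite eq_sym oner_eq0.
by rewrite subrX1; move: pq0; rewrite pE => /subr0_eq <-.
Qed.

(** Below the last index, [q ^+ i] factors out; at the last index the successor wraps to
    [q ^+ 0 = 1], and the equation on [q] is exactly what is needed. *)
Lemma geometric_absdiff (R : realDomainType) (k : nat) (q : R) (i : 'I_k) :
    1 <= q -> q ^+ k.-1 - 1 = (q - 1) * q ^+ k.-1 ->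
  `|q ^+ ordS i - q ^+ i| = (q - 1) * q ^+ i.
Proof.
move=> q_ge1 qk; have q1_ge0 : 0 <= q - 1 by rewrite subr_ge0.
have qi_ge0 : 0 <= q ^+ i by rewrite exprn_ge0 // (le_trans ler01).
have [ik|ik] := ltnP i.+1 k.
  by rewrite /= modn_small // exprS -[X in _ - X]mul1r -mulrBl ger0_norm ?mulr_ge0.
have ik1 : i.+1 = k by apply/eqP; rewrite eqn_leq ik ltn_ord.
have i_last : i = k.-1 :> nat by rewrite -[LHS]/(i.+1.-1) ik1.
rewrite /= ik1 modnn expr0 i_last distrC qk ger0_norm //.
by rewrite mulr_ge0 // exprn_ge0 // (le_trans ler01).
Qed.

(** The absolute value is 1-Lipschitz, and each of the two entries subtracted contributes an error
    of at most [e]. *)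
Lemma absdiff_approx (R : realDomainType) (k : nat) (S : k.-tuple nat)
    (v : 'I_k -> R) (e : R) :
    (forall i, `|(tnth S i)%:R - v i| <= e) ->
  forall i, `|(tnth (absdiff S) i)%:R - `|v (ordS i) - v i| | <= e *+ 2.
Proof.
move=> Sv i; rewrite tnth_mktuple natr_absz intr_norm rmorphB /=.
apply: le_trans (ler_dist_dist _ _) _.
rewrite opprD addrACA -opprD mulr2n.
by apply: le_trans (ler_normB _ _) _; rewrite lerD ?Sv.
Qed.

Lemma derived_approx (R : realDomainType) (k : nat) (S : k.-tuple nat)
    (c q : R) :
    0 <= c -> 1 <= q -> q ^+ k.-1 - 1 = (q - 1) * q ^+ k.-1 ->
    (forall i, `|(tnth S i)%:R - c * q ^+ i| <= 1) ->
  forall n i, `|(tnth (derived S n) i)%:R - c * (q - 1) ^+ n * q ^+ i| <= 2 ^+ n.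
Proof.
move=> c_ge0 q_ge1 qk Sq; elim=> [|n IHn] i; first by rewrite !mulr1.
have q1_ge0 : 0 <= q - 1 by rewrite subr_ge0.
have := absdiff_approx IHn i.
rewrite -mulrBr normrM geometric_absdiff // ger0_norm ?mulr_ge0 ?exprn_ge0 //.
by rewrite mulrA -[c * _ * (q - 1)]mulrA -exprSr -[_ ^+ n *+ 2]mulr_natr -exprSr.
Qed.

Local Close Scope ring_scope.

Theorem theorem3 (k : nat) (hk : 2 < k) (N : nat) (hN : 0 < N) :
  exists S0 : k.-tuple nat, N <= game_length S0.
Proof.
have k1_gt1 : 1 < k.-1 by rewrite -ltnS (ltn_predK hk).
have [q /andP[q_gt1 q_lt2] qk] := exists_multinacci realalg k1_gt1.
pose r := (q - 1)%R.
have r_gt0 : (0 < r)%R by rewrite subr_gt0.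
have r_lt1 : (r < 1)%R by rewrite /r; lra.
have d_gt0 : (0 < r ^+ N * (1 - r))%R by rewrite mulr_gt0 ?exprn_gt0 ?subr_gt0.
(* For [m < n <= N], [r ^+ m - r ^+ n >= r ^+ m * (1 - r) >= r ^+ N * (1 - r)]; this [M] scales that
   gap up to at least [2 ^+ N * 2]. *)
pose M := (2 ^+ N * 2 / (r ^+ N * (1 - r)))%R.
have M_ge0 : (0 <= M)%R by rewrite divr_ge0 ?(ltW d_gt0) // mulr_ge0 ?exprn_ge0.
pose S : k.-tuple nat := [tuple Num.truncn (M * q ^+ i)%R | i < k].
have S_approx (i : 'I_k) : (`|(tnth S i)%:R - M * q ^+ i| <= 1)%R.
  have Mq_ge0 : (0 <= M * q ^+ i)%R.
    by rewrite mulr_ge0 // exprn_ge0 // (le_trans ler01) ?ltW.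
  rewrite tnth_mktuple; have := truncn_itv Mq_ge0; rewrite -natr1.
  by move=> /andP[le_t lt_t]; rewrite ler_norml; apply/andP; split; lra.
have D_approx := derived_approx M_ge0 (ltW q_gt1) qk S_approx.
pose i0 := Ordinal (ltn_trans (ltn0Sn 1) hk).
exists S; apply: leq_game_length.
suff D_neq m n : m < n <= N -> derived S m <> derived S n.
  apply/mkseq_uniqP => m n; rewrite !inE !ltnS => mN nN Dmn.
  case: (ltngtP m n) => // mn; [have := @D_neq m n|have := @D_neq n m];
    by rewrite mn ?mN ?nN => /(_ isT) [].
move=> /andP[mn nN] Dmn.
have := D_approx m i0; have := D_approx n i0.
rewrite -Dmn !expr0 !mulr1 -/r !ler_norml => /andP[_ Dn] /andP[Dm _].
have gap : (2 ^+ N * 2 <= M * r ^+ m - M * r ^+ n)%R.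
  rewrite -[leLHS](divfK (lt0r_neq0 d_gt0)) -/M -mulrBr ler_wpM2l //.
  have rn : (r ^+ n <= r ^+ m * r)%R by rewrite -exprSr ler_wiXn2l ?ltW.
  apply: le_trans (_ : r ^+ m * (1 - r) <= _)%R; last by rewrite mulrBr mulr1 lerB.
  by rewrite ler_wpM2r ?subr_ge0 ?ler_wiXn2l ?ltW // (leq_trans (ltnW mn)).
have pow_n : (2 ^+ n <= 2 ^+ N :> realalg)%R by rewrite ler_weXn2l // ler1n.
(* Strict because [m < n <= N]: the two errors sum to less than [2 ^+ N * 2], which contradicts the
   non-strict [gap]. *)
have pow_m : (2 ^+ m < 2 ^+ N :> realalg)%R.
  by rewrite ltr_eXn2l ?ltr1n // (leq_trans mn).
by lra.
Qed.
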